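(* Let $(B_1,B_2,\mu_l,\nu_l,\mu_r,\nu_r)$ be a Hopf datum in a (strict) braided monoidal category $\mathcal C$. Define $$\phi_{1,2}=(\mathrm m_2\otimes\mathrm m_1)\circ(\mathrm{id}_2\otimes\Psi_{1,2}\otimes\mathrm{id}_1)\circ(\nu_l\otimes\nu_r):B_1\otimes B_2\to B_2\otimes B_1,$$ $$\phi_{2,1}=(\mu_l\otimes\mu_r)\circ(\mathrm{id}_2\otimes\Psi_{2,1}\otimes\mathrm{id}_1)\circ(\Delta_2\otimes\Delta_1):B_2\otimes B_1\to B_1\otimes B_2.$$ Then $B=B_1\otimes B_2$ is both an algebra and a coalgebra through the structure morphisms $$\mathrm m_B=(\mathrm m_1\otimes\mathrm m_2)\circ(\mathrm{id}_1\otimes\phi_{2,1}\otimes\mathrm{id}_2),\quad\eta_B=\eta_1\otimes\eta_2,$$ $$\Delta_B=(\mathrm{id}_1\otimes\phi_{1,2}\otimes\mathrm{id}_2)\circ(\Delta_1\otimes\Delta_2),\quad\varepsilon_B=\varepsilon_1\otimes\varepsilon_2.$$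
   Context: $\mathcal C$ has tensor product $\otimes$, unit object $I$, braiding $\Psi$, and idempotents in $\mathcal C$ split. Algebras are unital associative, coalgebras counital coassociative. Write $\mathrm{id}_j=\mathrm{id}_{B_j}$, $\Psi_{i,j}=\Psi_{B_i,B_j}$. Hopf datum. A Hopf datum $(B_1,B_2,\mu_l,\nu_l,\mu_r,\nu_r)$ consists of objects $B_1,B_2$, each an algebra $(\mathrm m_j,\eta_j)$ and a coalgebra $(\Delta_j,\varepsilon_j)$ such that $\varepsilon_j$ is an algebra morphism and $\eta_j$ is a coalgebra morphism; a left $B_2$-module structure $\mu_l:B_2\otimes B_1\to B_1$ and a left $B_2$-comodule structure $\nu_l:B_1\to B_2\otimes B_1$ on $B_1$; a right $B_1$-module structure $\mu_r:B_2\otimes B_1\to B_2$ and a right $B_1$-comodule structure $\nu_r:B_2\to B_2\otimes B_1$ on $B_2$, obeying (with $\phi_{1,2},\phi_{2,1}$ the composites displayed in the claim): - $\mu_r\circ(\eta_2\otimes\mathrm{id}_1)=\eta_2\circ\varepsilon_1=(\mathrm{id}_2\otimes\varepsilon_1)\circ\nu_l$; $\varepsilon_2\circ\mu_r=\varepsilon_2\otimes\varepsilon_1=\varepsilon_1\circ\mu_l$; $\mu_l\circ(\mathrm{id}_2\otimes\eta_1)=\eta_1\circ\varepsilon_2=(\varepsilon_2\otimes\mathrm{id}_1)\circ\nu_r$; $\nu_r\circ\eta_2=\eta_2\otimes\eta_1=\nu_l\circ\eta_1$. - Algebra-coalgebra: $\Delta_1\mathrm m_1=(\mathrm m_1\otimes\mathrm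 m_1)\circ(\mathrm{id}_1\otimes\mu_l\otimes\mathrm{id}_1\otimes\mathrm{id}_1)\circ(\mathrm{id}_1\otimes\mathrm{id}_2\otimes\Psi_{1,1}\otimes\mathrm{id}_1)\circ(\mathrm{id}_1\otimes\nu_l\otimes\mathrm{id}_1\otimes\mathrm{id}_1)\circ(\Delta_1\otimes\Delta_1)$ and $\Delta_2\mathrm m_2=(\mathrm m_2\otimes\mathrm m_2)\circ(\mathrm{id}_2\otimes\mathrm{id}_2\otimes\mu_r\otimes\mathrm{id}_2)\circ(\mathrm{id}_2\otimes\Psi_{2,2}\otimes\mathrm{id}_1\otimes\mathrm{id}_2)\circ(\mathrm{id}_2\otimes\mathrm{id}_2\otimes\nu_r\otimes\mathrm{id}_2)\circ(\Delta_2\otimes\Delta_2)$. - Module-comodule: $\phi_{1,2}\circ\phi_{2,1}=(\mathrm m_2\otimes\mathrm m_1)\circ(\mu_r\otimes\Psi_{1,2}\otimes\mu_l)\circ(\mathrm{id}_2\otimes\Psi_{1,1}\otimes\Psi_{2,2}\otimes\mathrm{id}_1)\circ(\nu_r\otimes\Psi_{2,1}\otimes\nu_l)\circ(\Delta_2\otimes\Delta_1)$. - Module-algebra: $\mu_r(\mathrm m_2\otimes\mathrm{id}_1)=\mathrm m_2(\mu_r\otimes\mathrm{id}_2)(\mathrm{id}_2\otimes\phi_{2,1})$; $\mu_l(\mathrm{id}_2\otimes\mathrm m_1)=\mathrm m_1(\mathrm{id}_1\otimes\mu_l)(\phi_{2,1}\otimes\mathrm{id}_1)$. - Comodule-coalgebra: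 $(\Delta_2\otimes\mathrm{id}_1)\nu_r=(\mathrm{id}_2\otimes\phi_{1,2})(\nu_r\otimes\mathrm{id}_2)\Delta_2$; $(\mathrm{id}_2\otimes\Delta_1)\nu_l=(\phi_{1,2}\otimes\mathrm{id}_1)(\mathrm{id}_1\otimes\nu_l)\Delta_1$. - Module-coalgebra: $\Delta_2\mu_r=(\mathrm m_2\otimes\mu_r)(\mu_r\otimes\Psi_{2,2}\otimes\mathrm{id}_1)(\mathrm{id}_2\otimes\Psi_{2,1}\otimes\nu_l)(\Delta_2\otimes\Delta_1)$; $\Delta_1\mu_l=(\mu_l\otimes\mathrm m_1)(\mathrm{id}_2\otimes\Psi_{1,1}\otimes\mu_l)(\nu_r\otimes\Psi_{2,1}\otimes\mathrm{id}_1)(\Delta_2\otimes\Delta_1)$. - Comodule-algebra: $\nu_r\mathrm m_2=(\mathrm m_2\otimes\mathrm m_1)(\mathrm{id}_2\otimes\Psi_{1,2}\otimes\mu_l)(\nu_r\otimes\Psi_{2,2}\otimes\mathrm{id}_1)(\Delta_2\otimes\nu_r)$; $\nu_l\mathrm m_1=(\mathrm m_2\otimes\mathrm m_1)(\mu_r\otimes\Psi_{1,2}\otimes\mathrm{id}_1)(\mathrm{id}_2\otimes\Psi_{1,1}\otimes\nu_l)(\nu_l\otimes\Delta_1)$. *)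

(* Defs.v *)
From mathcomp Require Import all_boot.
Set Implicit Arguments.
Unset Strict Implicit.
Unset Printing Implicit Defensive.

Declare Scope ob_scope.
Delimit Scope ob_scope with ob.
Declare Scope mor_scope.
Delimit Scope mor_scope with mor.

(* Strict monoidal categories in arrows-only form: one type of all morphisms
   with source and target maps.  Strictness is then plain Leibniz equality, on
   objects and on morphisms, without transports along equalities of objects.
   Composition comp g f ("g after f") is meaningful only when dom g = cod f; its
   value on other pairs is unconstrained, so that each law about composites is
   guarded by composability (or is about pairs that are always composable). *)
Record strictMonoidalCat := StrictMonoidalCat {
  ob : Type;
  mor : Type;
  dom : mor -> ob;
  cod : mor -> ob;
  idm : ob -> mor;
  comp : mor -> mor -> mor;
  dom_idm : forall A, dom (idm A) = A;
  cod_idm : forall A, cod (idm A) = A;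
  dom_comp : forall g f, dom g = cod f -> dom (comp g f) = dom f;
  cod_comp : forall g f, dom g = cod f -> cod (comp g f) = cod g;
  comp_idl : forall f, comp (idm (cod f)) f = f;
  comp_idr : forall f, comp f (idm (dom f)) = f;
  compA : forall h g f, dom h = cod g -> dom g = cod f ->
    comp h (comp g f) = comp (comp h g) f;
  unit_ob : ob;
  tens_ob : ob -> ob -> ob;
  tens : mor -> mor -> mor;
  dom_tens : forall f g, dom (tens f g) = tens_ob (dom f) (dom g);
  cod_tens : forall f g, cod (tens f g) = tens_ob (cod f) (cod g);
  tens_idm : forall A B, tens (idm A) (idm B) = idm (tens_ob A B);
  tens_comp : forall g f g' f', dom g = cod f -> dom g' = cod f' ->
    tens (comp g f) (comp g' f') = comp (tens g g') (tens f f');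
  tens_obA : associative tens_ob;
  tens_ob1l : left_id unit_ob tens_ob;
  tens_ob1r : right_id unit_ob tens_ob;
  tensA : associative tens;
  tens1l : left_id (idm unit_ob) tens;
  tens1r : right_id (idm unit_ob) tens
}.

Bind Scope ob_scope with ob.
Bind Scope mor_scope with mor.
Arguments idm {s} _%_ob.
Arguments comp {s} _%_mor _%_mor.
Arguments tens_ob {s} _%_ob _%_ob.
Arguments tens {s} _%_mor _%_mor.
Arguments unit_ob {s}.

Notation "A ⊗ B" := (tens_ob A B) (at level 40, left associativity) : ob_scope.
Notation "f ⊗ g" := (tens f g) (at level 40, left associativity) : mor_scope.
Notation "g ∘ f" := (comp g f) (at level 50, left associativity) : mor_scope.
Local Open Scope mor_scope.

Definition hom (C : strictMonoidalCat) (A B : ob C) (f : mor C) : Prop :=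
  dom f = A /\ cod f = B.

Arguments hom {C} (A B)%_ob f%_mor.

(* Compatibility of the braiding with the unit object follows from
   the two hexagons and invertibility. *)
Record strictBraidedCat := StrictBraidedCat {
  braided_base :> strictMonoidalCat;
  braid : ob braided_base -> ob braided_base -> mor braided_base;
  braid_hom : forall A B, hom (A ⊗ B) (B ⊗ A) (braid A B);
  braid_iso : forall A B, exists2 u : mor braided_base,
    hom (B ⊗ A) (A ⊗ B) u &
    u ∘ braid A B = idm (A ⊗ B) /\ braid A B ∘ u = idm (B ⊗ A);
  braid_natural : forall f g,
    braid (cod f) (cod g) ∘ (f ⊗ g) = (g ⊗ f) ∘ braid (dom f) (dom g);
  braid_tensr : forall A B D, braid A (B ⊗ D)%ob =
    (idm B ⊗ braid A D) ∘ (braid A B ⊗ idm D);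
  braid_tensl : forall A B D, braid (A ⊗ B)%ob D =
    (braid A D ⊗ idm B) ∘ (idm A ⊗ braid B D)
}.

Arguments braid {s} (_ _)%_ob.

Definition idempotents_split (C : strictMonoidalCat) : Prop :=
  forall (A : ob C) (e : mor C), hom A A e -> e ∘ e = e ->
  exists (X : ob C) (p i : mor C),
    [/\ hom A X p, hom X A i, i ∘ p = e & p ∘ i = idm X].

Section Algebras.
Context {C : strictMonoidalCat}.
Implicit Types A X : ob C.
Implicit Types f m eta Delta eps mu nu : mor C.

Record is_algebra A m eta : Prop := IsAlgebra {
  mult_hom : hom (A ⊗ A) A m;
  unit_hom : hom unit_ob A eta;
  multA : m ∘ (m ⊗ idm A) = m ∘ (idm A ⊗ m);
  mult_unitl : m ∘ (eta ⊗ idm A) = idm A;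
  mult_unitr : m ∘ (idm A ⊗ eta) = idm A
}.

Record is_coalgebra A Delta eps : Prop := IsCoalgebra {
  comult_hom : hom A (A ⊗ A) Delta;
  counit_hom : hom A unit_ob eps;
  comultA : (Delta ⊗ idm A) ∘ Delta = (idm A ⊗ Delta) ∘ Delta;
  comult_counitl : (eps ⊗ idm A) ∘ Delta = idm A;
  comult_counitr : (idm A ⊗ eps) ∘ Delta = idm A
}.

Definition algebra_morphism A m eta A' m' eta' f : Prop :=
  [/\ hom A A' f, f ∘ m = m' ∘ (f ⊗ f) & f ∘ eta = eta'].

Definition coalgebra_morphism A Delta eps A' Delta' eps' f : Prop :=
  [/\ hom A A' f, Delta' ∘ f = (f ⊗ f) ∘ Delta & eps' ∘ f = eps].

(* The unit object is an algebra and a coalgebra through identities, since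
   unit_ob ⊗ unit_ob = unit_ob. *)
Definition augmentation A m eta eps : Prop :=
  algebra_morphism A m eta unit_ob (idm unit_ob) (idm unit_ob) eps.

Definition coaugmentation A Delta eps eta : Prop :=
  coalgebra_morphism unit_ob (idm unit_ob) (idm unit_ob) A Delta eps eta.

Definition left_module A m eta X mu : Prop :=
  [/\ hom (A ⊗ X) X mu,
      mu ∘ (m ⊗ idm X) = mu ∘ (idm A ⊗ mu)
    & mu ∘ (eta ⊗ idm X) = idm X].

Definition right_module A m eta X mu : Prop :=
  [/\ hom (X ⊗ A) X mu,
      mu ∘ (idm X ⊗ m) = mu ∘ (mu ⊗ idm A)
    & mu ∘ (idm X ⊗ eta) = idm X].

Definition left_comodule A Delta eps X nu : Prop :=
  [/\ hom X (A ⊗ X) nu,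
      (Delta ⊗ idm X) ∘ nu = (idm A ⊗ nu) ∘ nu
    & (eps ⊗ idm X) ∘ nu = idm X].

Definition right_comodule A Delta eps X nu : Prop :=
  [/\ hom X (X ⊗ A) nu,
      (idm X ⊗ Delta) ∘ nu = (nu ⊗ idm A) ∘ nu
    & (idm X ⊗ eps) ∘ nu = idm X].

End Algebras.

(* The data underlying a Hopf datum, without its axioms. *)
Record hopfData (C : strictMonoidalCat) := HopfData {
  ob1 : ob C;
  ob2 : ob C;
  mul1 : mor C;
  one1 : mor C;
  comul1 : mor C;
  counit1 : mor C;
  mul2 : mor C;
  one2 : mor C;
  comul2 : mor C;
  counit2 : mor C;
  actl : mor C;
  coactl : mor C;
  actr : mor C;
  coactr : mor C
}.

Section HopfDatum.
Context {C : strictBraidedCat} (H : hopfData C).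

Local Notation B1 := (ob1 H).
Local Notation B2 := (ob2 H).
Local Notation m1 := (mul1 H).
Local Notation η1 := (one1 H).
Local Notation Δ1 := (comul1 H).
Local Notation ε1 := (counit1 H).
Local Notation m2 := (mul2 H).
Local Notation η2 := (one2 H).
Local Notation Δ2 := (comul2 H).
Local Notation ε2 := (counit2 H).
Local Notation μl := (actl H).
Local Notation νl := (coactl H).
Local Notation μr := (actr H).
Local Notation νr := (coactr H).
Local Notation id1 := (idm B1).
Local Notation id2 := (idm B2).
Local Notation Ψ11 := (braid B1 B1).
Local Notation Ψ12 := (braid B1 B2).
Local Notation Ψ21 := (braid B2 B1).
Local Notation Ψ22 := (braid B2 B2).

Definition phi12 : mor C := (m2 ⊗ m1) ∘ (id2 ⊗ Ψ12 ⊗ id1) ∘ (νl ⊗ νr).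

Definition phi21 : mor C := (μl ⊗ μr) ∘ (id2 ⊗ Ψ21 ⊗ id1) ∘ (Δ2 ⊗ Δ1).

Local Notation φ12 := phi12.
Local Notation φ21 := phi21.

Record is_hopf_datum : Prop := IsHopfDatum {
  algebra1 : is_algebra B1 m1 η1;
  algebra2 : is_algebra B2 m2 η2;
  coalgebra1 : is_coalgebra B1 Δ1 ε1;
  coalgebra2 : is_coalgebra B2 Δ2 ε2;
  counit1_algmor : augmentation B1 m1 η1 ε1;
  counit2_algmor : augmentation B2 m2 η2 ε2;
  one1_coalgmor : coaugmentation B1 Δ1 ε1 η1;
  one2_coalgmor : coaugmentation B2 Δ2 ε2 η2;

  actl_module : left_module B2 m2 η2 B1 μl;
  coactl_comodule : left_comodule B2 Δ2 ε2 B1 νl;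
  actr_module : right_module B1 m1 η1 B2 μr;
  coactr_comodule : right_comodule B1 Δ1 ε1 B2 νr;

  actr_one : μr ∘ (η2 ⊗ id1) = η2 ∘ ε1;
  coactl_counit : η2 ∘ ε1 = (id2 ⊗ ε1) ∘ νl;
  counit_actr : ε2 ∘ μr = ε2 ⊗ ε1;
  counit_actl : ε2 ⊗ ε1 = ε1 ∘ μl;
  actl_one : μl ∘ (id2 ⊗ η1) = η1 ∘ ε2;
  coactr_counit : η1 ∘ ε2 = (ε2 ⊗ id1) ∘ νr;
  coactr_one : νr ∘ η2 = η2 ⊗ η1;
  coactl_one : η2 ⊗ η1 = νl ∘ η1;

  alg_coalg1 : Δ1 ∘ m1 =
    (m1 ⊗ m1) ∘ (id1 ⊗ μl ⊗ id1 ⊗ id1) ∘ (id1 ⊗ id2 ⊗ Ψ11 ⊗ id1)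
    ∘ (id1 ⊗ νl ⊗ id1 ⊗ id1) ∘ (Δ1 ⊗ Δ1);
  alg_coalg2 : Δ2 ∘ m2 =
    (m2 ⊗ m2) ∘ (id2 ⊗ id2 ⊗ μr ⊗ id2) ∘ (id2 ⊗ Ψ22 ⊗ id1 ⊗ id2)
    ∘ (id2 ⊗ id2 ⊗ νr ⊗ id2) ∘ (Δ2 ⊗ Δ2);

  mod_comod : φ12 ∘ φ21 =
    (m2 ⊗ m1) ∘ (μr ⊗ Ψ12 ⊗ μl) ∘ (id2 ⊗ Ψ11 ⊗ Ψ22 ⊗ id1)
    ∘ (νr ⊗ Ψ21 ⊗ νl) ∘ (Δ2 ⊗ Δ1);

  mod_alg2 : μr ∘ (m2 ⊗ id1) = m2 ∘ (μr ⊗ id2) ∘ (id2 ⊗ φ21);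
  mod_alg1 : μl ∘ (id2 ⊗ m1) = m1 ∘ (id1 ⊗ μl) ∘ (φ21 ⊗ id1);

  comod_coalg2 : (Δ2 ⊗ id1) ∘ νr = (id2 ⊗ φ12) ∘ (νr ⊗ id2) ∘ Δ2;
  comod_coalg1 : (id2 ⊗ Δ1) ∘ νl = (φ12 ⊗ id1) ∘ (id1 ⊗ νl) ∘ Δ1;

  mod_coalg2 : Δ2 ∘ μr =
    (m2 ⊗ μr) ∘ (μr ⊗ Ψ22 ⊗ id1) ∘ (id2 ⊗ Ψ21 ⊗ νl) ∘ (Δ2 ⊗ Δ1);
  mod_coalg1 : Δ1 ∘ μl =
    (μl ⊗ m1) ∘ (id2 ⊗ Ψ11 ⊗ μl) ∘ (νr ⊗ Ψ21 ⊗ id1) ∘ (Δ2 ⊗ Δ1);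

  comod_alg2 : νr ∘ m2 =
    (m2 ⊗ m1) ∘ (id2 ⊗ Ψ12 ⊗ μl) ∘ (νr ⊗ Ψ22 ⊗ id1) ∘ (Δ2 ⊗ νr);
  comod_alg1 : νl ∘ m1 =
    (m2 ⊗ m1) ∘ (μr ⊗ Ψ12 ⊗ id1) ∘ (id2 ⊗ Ψ11 ⊗ νl) ∘ (νl ⊗ Δ1)
}.

Definition obB : ob C := (B1 ⊗ B2)%ob.
Definition mulB : mor C := (m1 ⊗ m2) ∘ (id1 ⊗ φ21 ⊗ id2).
Definition oneB : mor C := η1 ⊗ η2.
Definition comulB : mor C := (id1 ⊗ φ12 ⊗ id2) ∘ (Δ1 ⊗ Δ2).
Definition counitB : mor C := ε1 ⊗ ε2.

End HopfDatum.

(* Main.v *)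
(* [mulB] is associative as soon as [phi21] is compatible with the products of
   both factors (a distributive law), and dually for [comulB] and [phi12].
   In Sweedler notation, for a, b in B_2 and x in B_1,
     phi21 (ab, x) = a1 ▷ (b1^0 ▷ x1) ⊗ (a2 ◁ b1^1 (b2 ▷ x2)) (b3 ◁ x3):
   one side uses the formula for [Delta_2 m_2] and the module-algebra axiom for
   ◁, the other the module-coalgebra axiom for ▷.  Reflecting the string diagrams
   left-right exchanges B_1 and B_2, and reading them upside down exchanges
   [phi21] and [phi12]; the other three compatibilities are these images. *)
From mathcomp Require Import all_boot zify.
Require Import Defs.
Set Implicit Arguments.
Unset Strict Implicit.
Unset Printing Implicit Defensive.

Local Open Scope mor_scope.

(** * String diagrams over a strict monoidal category, as lists of slices *)

Section StringDiagrams.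

Variables (C : strictMonoidalCat).
Variables (obs : seq (ob C)) (arity : seq (seq nat * seq nat)) (gens : seq (mor C)).

Definition src g := (nth ([::], [::]) arity g).1.
Definition tgt g := (nth ([::], [::]) arity g).2.

Definition obI (w : seq nat) : ob C :=
  foldr (fun a X => (nth unit_ob obs a ⊗ X)%ob) unit_ob w.
Definition genI g : mor C := nth (idm unit_ob) gens g.

Definition well_typed_gens :=
  forall g, g < size arity -> hom (obI (src g)) (obI (tgt g)) (genI g).

(* [(n, g)] stands for [idm ⊗ g ⊗ idm] with [n] wires to the left of [g]; a
   diagram is a list of slices, the first one being applied first. *)
Definition slice := (nat * nat)%type.
Definition whisk u (f : mor C) v := idm (obI u) ⊗ f ⊗ idm (obI v).
Definition shift n (d : seq slice) := [seq (n + s.1, s.2) | s <- d].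

(** A relation, because [comp] is constrained only on composable pairs: an ill-typed diagram denotes
    nothing. *)
Fixpoint denotes w (d : seq slice) w' f : Prop :=
  if d is s :: d' then exists u v f',
    [/\ w = u ++ src s.2 ++ v, size u = s.1, s.2 < size arity,
        denotes (u ++ tgt s.2 ++ v) d' w' f' & f = f' ∘ whisk u (genI s.2) v]
  else w = w' /\ f = idm (obI w).

Fixpoint run w (d : seq slice) : option (seq nat) :=
  if d is s :: d' then
    if [&& s.2 < size arity, s.1 <= size w
         & prefix (src s.2) (drop s.1 w)]
    then run (take s.1 w ++ tgt s.2 ++ drop (size (src s.2)) (drop s.1 w)) d'
    else None
  else Some w.

(* [s] is applied before [t]; the result lists the slices in the opposite order. *)
Definition commute (s t : slice) : option (slice * slice) :=
  if t.1 + size (src t.2) <= s.1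
  then Some (t, (s.1 - size (src t.2) + size (tgt t.2), s.2))
  else if s.1 + size (tgt s.2) <= t.1
  then Some ((t.1 - size (tgt s.2) + size (src s.2), t.2), s)
  else None.

(** By the interchange law [s] slides past later slices lying wholly to its left. Only preservation
    of values is proved of the resulting sort, so equality of sorted lists serves as a sufficient
    test for equality. *)
Fixpoint insert (s : slice) (d : seq slice) :=
  if d is t :: d' then
    if t.1 + size (src t.2) <= s.1
    then t :: insert (s.1 - size (src t.2) + size (tgt t.2), s.2) d'
    else s :: d
  else [:: s].

Definition sort_slices (d : seq slice) := foldr insert [::] d.

Fixpoint push_right (t : slice) (d : seq slice) : option (seq slice * slice) :=
  if d is s :: d' then
    if commute t s is Some (s', t') then
      if push_right t' d' is Some (d'', t'') then Some (s' :: d'', t'') else None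
    else None
  else Some ([::], t).

Fixpoint push_left (d : seq slice) (t : slice) : option (slice * seq slice) :=
  if d is s :: d' then
    if push_left d' t is Some (t', d'') then
      if commute s t' is Some (t'', s') then Some (t'', s' :: d'') else None
    else None
  else Some (t, [::]).

(** Slices that can slide past the segment are sent to [rest]; those kept in front of the anchor
    block the way to it. *)
Fixpoint gather_before (rpre seg rest : seq slice) :=
  if rpre is t :: rpre' then
    if push_right t seg is Some (seg', t')
    then gather_before rpre' seg' (t' :: rest)
    else gather_before rpre' (t :: seg) rest
  else (seg, rest).

(** The diagram is [pre ++ block ++ mid ++ rest], with [block] the part of [l] found so far. The
    next slice joins [block] if it continues [l], passes to [pre] if it can slide before [block],
    and waits in [mid] otherwise. Each match returns [mid] to [rest], hence the fuel. *)
Fixpoint gather_after fuel (l pre block mid rest : seq slice) k0 :=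
  let n := (head (0, 0) block).1 - k0 in
  if size l == size block then Some (pre, n, mid ++ rest)
  else if (fuel, rest) is (fuel'.+1, s :: rest') then
    if push_left mid s is Some (s', mid') then
      let t := nth (0, 0) l (size block) in
      if s' == (n + t.1, t.2)
      then gather_after fuel' l pre (rcons block s') [::] (mid' ++ rest') k0
      else if push_left block s' is Some (s'', block')
      then gather_after fuel' l (rcons pre s'') block' mid' rest' k0
      else gather_after fuel' l pre block (rcons mid s) rest' k0
    else gather_after fuel' l pre block (rcons mid s) rest' k0
  else None.

(* [gather l d i] tries to bring together the slices of an occurrence of [l] whose
   first slice is the [i]-th one of [d].  Nothing is proved about it: its
   result is compared with [d] through [sort_slices]. *)
Definition gather (l d : seq slice) i :=
  let s := nth (0, 0) d i in let s0 := head (0, 0) l in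
  if s.2 == s0.2 then
    let (seg, rest) := gather_before (rev (take i d)) [:: s] (drop i.+1 d) in
    let anc := take (size seg).-1 seg in
    let s' := last s seg in
    if s0.1 <= s'.1
    then gather_after (size l * size d) l anc [:: s'] [::] rest s0.1
    else None
  else None.

(** The tests certify the proposed factorization. The last one compares the whole source word [wl],
    since [r] may use wires that [l] leaves untouched. *)
Definition rewrite_slices w (d : seq slice) wl l r : option (seq slice) :=
  if ohead (pmap (gather l d) (iota 0 (size d))) is Some (pre, n, post) then
    let d' := pre ++ shift n r ++ post in
    if [&& sort_slices d == sort_slices (pre ++ shift n l ++ post),
      isSome (run w (pre ++ shift n l ++ post))
      & if run w pre is Some w1
        then (n <= size w1) && prefix wl (drop n w1) else false]
    then Some d' else None
  else None.

(** [Id] is a single wire and [Id1] the empty word; an identity on a tensor product has to be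
    written as a tensor product of these. *)
Inductive term :=
  | Gen of nat | Id of nat | Id1 | Comp of term & term | Tens of term & term.

Fixpoint termI t : mor C :=
  match t with
  | Gen g => genI g
  | Id a => idm (nth unit_ob obs a)
  | Id1 => idm unit_ob
  | Comp t1 t2 => termI t1 ∘ termI t2
  | Tens t1 t2 => termI t1 ⊗ termI t2
  end.

Fixpoint tsrc t :=
  match t with
  | Gen g => src g | Id a => [:: a] | Id1 => [::] | Comp t1 t2 => tsrc t2
  | Tens t1 t2 => tsrc t1 ++ tsrc t2
  end.

Fixpoint ttgt t :=
  match t with
  | Gen g => tgt g | Id a => [:: a] | Id1 => [::] | Comp t1 t2 => ttgt t1
  | Tens t1 t2 => ttgt t1 ++ ttgt t2
  end.

Fixpoint typed t :=
  match t with
  | Gen g => g < size arity | Id a => true | Id1 => true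
  | Comp t1 t2 => [&& typed t1, typed t2 & tsrc t1 == ttgt t2]
  | Tens t1 t2 => typed t1 && typed t2
  end.

(** In a tensor product the left factor is applied first, so the right factor is shifted by the
    length of the target of the left one. *)
Fixpoint slices t : seq slice :=
  match t with
  | Gen g => [:: (0, g)] | Id a => [::] | Id1 => [::]
  | Comp t1 t2 => slices t2 ++ slices t1
  | Tens t1 t2 => slices t1 ++ shift (size (ttgt t1)) (slices t2)
  end.

(** * Soundness of sorting and rewriting of diagrams *)

Hypothesis gens_typed : well_typed_gens.

Lemma obI_cat u v : obI (u ++ v) = (obI u ⊗ obI v)%ob.
Proof. by elim: u => [|a u IH] /=; rewrite ?tens_ob1l // IH tens_obA. Qed.

Lemma idm_cat u v : idm (obI (u ++ v)) = idm (obI u) ⊗ idm (obI v).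
Proof. by rewrite obI_cat tens_idm. Qed.

Lemma whisk_hom w w' u f v : hom (obI w) (obI w') f ->
  hom (obI (u ++ w ++ v)) (obI (u ++ w' ++ v)) (whisk u f v).
Proof.
case=> df cf; rewrite /hom /whisk !dom_tens !cod_tens !dom_idm !cod_idm df cf.
by rewrite !obI_cat !tens_obA.
Qed.

Lemma comp_id_cod A (f : mor C) : cod f = A -> idm A ∘ f = f.
Proof. by move<-; rewrite comp_idl. Qed.

Lemma comp_id_dom A (f : mor C) : dom f = A -> f ∘ idm A = f.
Proof. by move<-; rewrite comp_idr. Qed.

Lemma whisk_comp u v A B D (f g : mor C) : hom A B f -> hom B D g ->
  whisk u (g ∘ f) v = whisk u g v ∘ whisk u f v.
Proof.
move=> [df cf] [dg cg]; rewrite /whisk.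
rewrite -!tens_comp ?dom_tens ?cod_tens ?dom_idm ?cod_idm ?df ?cf ?dg ?cg //.
by rewrite !comp_id_cod ?cod_idm.
Qed.

Lemma hom_comp A B D (f g : mor C) : hom A B f -> hom B D g -> hom A D (g ∘ f).
Proof. by move=> [df cf] [dg cg]; split; rewrite ?dom_comp ?cod_comp ?cf ?dg. Qed.

Lemma hom_idm A : hom A A (idm A : mor C).
Proof. by split; rewrite ?dom_idm ?cod_idm. Qed.

Lemma hom_tens A B A' B' (f g : mor C) : hom A B f -> hom A' B' g ->
  hom (A ⊗ A') (B ⊗ B') (f ⊗ g).
Proof. by move=> [df cf] [dg cg]; split; rewrite ?dom_tens ?cod_tens ?df ?cf ?dg ?cg. Qed.

Lemma denotes_hom w d w' f : denotes w d w' f -> hom (obI w) (obI w') f.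
Proof.
elim: d w f => [|s d IH] w f /=; first by case=> -> ->; apply: hom_idm.
case=> u [v [f' [-> _ sg /IH Hf' ->]]].
exact: hom_comp (whisk_hom _ _ (gens_typed sg)) Hf'.
Qed.

(** The position and label of a slice determine how the word is split. *)
Lemma denotes_fun w d w1 f w2 g :
  denotes w d w1 f -> denotes w d w2 g -> w1 = w2 /\ f = g.
Proof.
elim: d w f g => [|s d IH] w f g /=; first by case=> <- -> [<- ->].
case=> u [v [f' [-> su _ Hf' ->]]] [u2 [v2 [g' [/eqP e su2 _ Hg' ->]]]].
move: e; rewrite eqseq_cat ?su ?su2 // => /andP[/eqP e]; rewrite eqseq_cat // eqxx /=.
move/eqP=> e2; rewrite -e -e2 in Hg' *.
by case: (IH _ _ _ Hf' Hg') => -> ->.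
Qed.

Lemma denotes_cat w d1 w1 f d2 w2 g :
  denotes w d1 w1 f -> denotes w1 d2 w2 g -> denotes w (d1 ++ d2) w2 (g ∘ f).
Proof.
move=> + Hg; elim: d1 w f => [|s d1 IH] w f /=.
  by case=> -> ->; rewrite comp_id_dom //; case: (denotes_hom Hg).
case=> u [v [f' [-> su sg Hf' ->]]]; exists u, v, (g ∘ f'); split=> //; first exact: IH.
have [dg _] := denotes_hom Hg; have [df cf] := denotes_hom Hf'.
have [dh ch] := whisk_hom u v (gens_typed sg).
by rewrite compA ?dg ?cf ?df ?ch.
Qed.

Lemma denotes_shift w d w' f u v : denotes w d w' f ->
  denotes (u ++ w ++ v) (shift (size u) d) (u ++ w' ++ v) (whisk u f v).
Proof.
elim: d w f => [|s d IH] w f /=.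
  by case=> -> ->; split=> //; rewrite /whisk !tens_idm !obI_cat tens_obA.
case=> x [y [f' [-> sx sg Hf' ->]]].
exists (u ++ x), (y ++ v), (whisk u f' v); split=> //.
- by rewrite !catA.
- by rewrite size_cat sx.
- by move: (IH _ _ Hf'); rewrite -!catA.
rewrite (whisk_comp u v (whisk_hom _ _ (gens_typed sg)) (denotes_hom Hf')).
by rewrite /whisk !idm_cat !tensA.
Qed.

Lemma denotes_run w d w' : run w d = Some w' -> exists f, denotes w d w' f.
Proof.
elim: d w => [|s d IH] w /=.
  by case=> <-; exists (idm (obI w)).
case: ifP => // /and3P[sg sw /prefixP[v e]] /IH[f Hf].
exists (f ∘ whisk (take s.1 w) (genI s.2) (drop (size (src s.2)) (drop s.1 w))).
exists (take s.1 w), (drop (size (src s.2)) (drop s.1 w)), f; split=> //.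
- by rewrite e drop_size_cat // -e cat_take_drop.
- by rewrite size_takel.
Qed.

(* Both composites are [idm u ⊗ g ⊗ idm z ⊗ f ⊗ idm v]. *)
Lemma interchange A A' B B' (f g : mor C) u z v :
  hom (obI A) (obI A') f -> hom (obI B) (obI B') g ->
  whisk u g (z ++ A' ++ v) ∘ whisk (u ++ B ++ z) f v =
  whisk (u ++ B' ++ z) f v ∘ whisk u g (z ++ A ++ v).
Proof.
move=> [df cf] [dg cg]; rewrite /whisk !idm_cat !tensA.
do 12?rewrite -tens_comp ?dom_tens ?cod_tens ?dom_idm ?cod_idm ?df ?cf ?dg ?cg //.
by rewrite !comp_id_cod ?cod_idm // !comp_id_dom ?dom_idm // !comp_id_cod.
Qed.

Lemma cat_eq_catP (T : eqType) (x y a b : seq T) :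
  x ++ y = a ++ b -> size a <= size x -> exists2 z, x = a ++ z & b = z ++ y.
Proof.
move=> e le; exists (drop (size a) x).
  move/(congr1 (take (size a))): e; rewrite takel_cat // take_size_cat // => {1}<-.
  by rewrite cat_take_drop.
move/(congr1 (drop (size a))): e; rewrite [RHS]drop_size_cat // => <-.
by rewrite drop_cat; case: ltngtP le => // -> _; rewrite subnn drop0 drop_size.
Qed.

Lemma denotes_swap w (s t : slice) d w' f : t.1 + size (src t.2) <= s.1 ->
  denotes w [:: s, t & d] w' f ->
  denotes w [:: t, (s.1 - size (src t.2) + size (tgt t.2), s.2) & d] w' f.
Proof.
case: s t => [n g] [k h] /= le [u [v [_ [-> su sg [u2 [v2 [f2 [e su2 sh Hf2 ->]]]] ->]]]].
(* The left context [u] of [s] is [u2 ++ src h ++ z], where [z] is the wires between the two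
   slices. *)
rewrite [RHS]catA in e; case: (cat_eq_catP e _) => [|z eu ev].
  by rewrite size_cat su2 su.
move: e => _; rewrite {}ev in Hf2 *; rewrite {u}eu -?catA !size_cat in su *.
exists u2, (z ++ src g ++ v), (f2 ∘ whisk (u2 ++ tgt h ++ z) (genI g) v).
have {}Hf2 : denotes ((u2 ++ tgt h ++ z) ++ tgt g ++ v) d w' f2 by rewrite -?catA.
split=> //.
  exists (u2 ++ tgt h ++ z), v, f2; split=> //; first by rewrite -?catA.
  by rewrite !size_cat; lia.
have [d2 c2] := denotes_hom Hf2.
have hg := gens_typed sg; have hh := gens_typed sh.
have [dg cg] := whisk_hom (u2 ++ src h ++ z) v hg.
have [dg' cg'] := whisk_hom (u2 ++ tgt h ++ z) v hg.
have [dh ch] := whisk_hom u2 (z ++ tgt g ++ v) hh.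
have [dh' ch'] := whisk_hom u2 (z ++ src g ++ v) hh.
rewrite -!catA in d2 dg cg dg' cg' dh ch dh' ch'.
rewrite -compA ?d2 ?dg ?cg ?dh ?ch // (interchange u2 z v hg hh).
by rewrite compA ?d2 ?dg' ?cg' ?dh' ?ch'.
Qed.

Lemma denotes_sort w d w' f :
  denotes w d w' f -> denotes w (sort_slices d) w' f.
Proof.
have ins s d1 w1 f1 : denotes w1 (s :: d1) w' f1 -> denotes w1 (insert s d1) w' f1.
  elim: d1 s w1 f1 => [|t d1 IH] s w1 f1 // Hf1 /=; case: ifP => // le.
  have [u [v [f2 [e su st /IH H2 ->]]]] := denotes_swap le Hf1.
  by exists u, v, f2.
elim: d w f => [|s d IH] w f //= [u [v [f2 [e su st /IH H2 ->]]]].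
by apply: ins; exists u, v, f2.
Qed.

(** Both values are values of the common sorted list, hence equal; the [run] test ensures that [d']
    has a value. *)
Lemma sort_slices_eq w d d' w' f : sort_slices d = sort_slices d' ->
  isSome (run w d') -> denotes w d w' f -> denotes w d' w' f.
Proof.
move=> e; case E: (run w d') => [w2|] // _ Hf; have [f' Hf'] := denotes_run E.
have := denotes_sort Hf'; rewrite -e => /denotes_fun/(_ (denotes_sort Hf)).
by case=> <- <-.
Qed.

Lemma denotes_cat_inv w d1 d2 w2 h : denotes w (d1 ++ d2) w2 h ->
  exists w1 f g, [/\ denotes w d1 w1 f, denotes w1 d2 w2 g & h = g ∘ f].
Proof.
elim: d1 w h => [|s d1 IH] w h /= => [Hh|].
  exists w, (idm (obI w)), h; split=> //; rewrite comp_id_dom //.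
  by case: (denotes_hom Hh).
case=> u [v [f' [-> su sg /IH[w1 [f [g [Hf Hg ->]]]] ->]]].
exists w1, (f ∘ whisk u (genI s.2) v), g; split=> //; first by exists u, v, f.
have [dg _] := denotes_hom Hg; have [df cf] := denotes_hom Hf.
have [dh ch] := whisk_hom u v (gens_typed sg).
by rewrite compA ?dg ?cf ?df ?ch.
Qed.

Lemma denotes_slices t : typed t -> denotes (tsrc t) (slices t) (ttgt t) (termI t).
Proof.
elim: t => [g|a||t1 IH1 t2 IH2|t1 IH1 t2 IH2] /=.
- move=> sg; exists [::], [::], (idm (obI (tgt g))); rewrite cats0; split=> //=.
    by rewrite cats0.
  rewrite /whisk tens1l tens1r comp_id_cod //.
  by case: (gens_typed sg).
- by rewrite tens_ob1r.
- by [].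
- move=> /and3P[/IH1 H1 /IH2 H2 /eqP e]; rewrite e in H1; exact: denotes_cat H2 H1.
move=> /andP[/IH1 H1 /IH2 H2].
have [[d1 c1] [d2 c2]] := (denotes_hom H1, denotes_hom H2).
(* A tensor product is sliced as [f ⊗ g = (id ⊗ g) ∘ (f ⊗ id)]. *)
have := denotes_shift [::] (tsrc t2) H1; have := denotes_shift (ttgt t1) [::] H2.
rewrite !cats0 /= /whisk tens1l tens1r => {}H2 {}H1.
have e : shift 0 (slices t1) = slices t1 by rewrite /shift map_id_in // => -[].
rewrite e in H1.
have := denotes_cat H1 H2.
by rewrite -tens_comp ?dom_idm ?cod_idm // comp_id_cod // comp_id_dom.
Qed.

Lemma denotes_rewrite w d d' w' f l r :
  typed l -> typed r -> tsrc l = tsrc r -> ttgt l = ttgt r -> termI l = termI r ->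
  rewrite_slices w d (tsrc l) (slices l) (slices r) = Some d' ->
  denotes w d w' f -> denotes w d' w' f.
Proof.
move=> /denotes_slices Hl /denotes_slices Hr es et elr.
rewrite -es -et -elr in Hr; rewrite /rewrite_slices.
case: ohead => [[[pre n] post]|] //; case: ifP => // /and3P[/eqP esort run_ok].
case E: run => [w1|] // /andP[nw /prefixP[v ev]] [<-].
(* The certified factorization has the same value as [d]; it is cut around the occurrence of [l],
   whose whiskered value is also that of [r]. *)
move/(sort_slices_eq esort run_ok) => /denotes_cat_inv[w1' [f1 [f2 [H1 H2 ->]]]].
have [f1' /denotes_fun/(_ H1)[ew _]] := denotes_run E; rewrite -{}ew in H1 H2.
move/denotes_cat_inv: H2 => [w2 [f3 [f4 [H3 H4 ->]]]].
have ew1 : w1 = take n w1 ++ tsrc l ++ v by rewrite -ev cat_take_drop.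
have sn : size (take n w1) = n by rewrite size_takel.
have := denotes_shift (take n w1) v Hl; have := denotes_shift (take n w1) v Hr.
rewrite sn -ew1 => Hr' /denotes_fun/(_ H3)[ew2 ef3].
rewrite ew2 ef3 in Hr'.
apply: denotes_cat H1 _; exact: denotes_cat Hr' H4.
Qed.

(** Quantifying over the value lets a proof carry only the diagram; [draws_start] supplies the value
    once, from typing. *)
Definition draws w d w' (e : mor C) := forall f, denotes w d w' f -> f = e.

Lemma draws_start t e : typed t ->
  draws (tsrc t) (slices t) (ttgt t) e -> termI t = e.
Proof. by move=> /denotes_slices Ht /(_ _ Ht). Qed.

Lemma draws_rewrite l r w d w' e d' : termI l = termI r ->
  [&& typed l, typed r, tsrc l == tsrc r & ttgt l == ttgt r] ->
  rewrite_slices w d (tsrc l) (slices l) (slices r) = Some d' ->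
  draws w d' w' e -> draws w d w' e.
Proof.
move=> elr /and4P[tl tr /eqP es /eqP et] rw dr f.
by move/(denotes_rewrite tl tr es et elr rw)/dr.
Qed.

Lemma draws_end t w d w' :
  [&& typed t, w == tsrc t & sort_slices d == sort_slices (slices t)] ->
  draws w d w' (termI t).
Proof.
case/and3P=> tt /eqP-> /eqP es f /denotes_sort.
have := denotes_sort (denotes_slices tt); rewrite -es => H /denotes_fun/(_ H).
by case.
Qed.

End StringDiagrams.

(** * Tactics for diagrammatic rewriting *)

Ltac index_of x l :=
  lazymatch l with
  | x :: _ => constr:(0)
  | _ :: ?l' => let n := index_of x l' in constr:(S n)
  end.

Ltac reify_term obs gens e :=
  lazymatch e with
  | comp ?g ?f => let t1 := reify_term obs gens g in
                  let t2 := reify_term obs gens f in constr:(Comp t1 t2)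
  | tens ?f ?g => let t1 := reify_term obs gens f in
                  let t2 := reify_term obs gens g in constr:(Tens t1 t2)
  | idm unit_ob => constr:(Id1)
  | idm ?A => let i := index_of A obs in constr:(Id i)
  | ?g => let i := index_of g gens in constr:(Gen i)
  end.

(** [draw] turns the left side of an equation into a diagram, [redraw] applies an equation left to
    right modulo interchange, and [drawn] compares the diagram with the right side. *)
Ltac draw M :=
  lazymatch type of M with
  | @well_typed_gens _ ?obs ?arity ?gens =>
    lazymatch goal with
    | |- ?e = ?e' =>
      let obs' := eval hnf in obs in
      let gens' := eval hnf in gens in
      let t := reify_term obs' gens' e in
      let w := eval vm_compute in (tsrc arity t) in
      let d := eval vm_compute in (slices arity t) in
      let w' := eval vm_compute in (ttgt arity t) in
      refine (@draws_start _ obs arity gens M t e' _ (_ : draws obs arity gens w d w' e'));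
        [vm_compute; reflexivity |]
    end
  end.

Ltac redraw M H :=
  lazymatch type of M with
  | @well_typed_gens _ ?obs ?arity ?gens =>
    lazymatch goal with
    | |- draws _ _ _ ?w ?d ?w' ?e =>
      let obs' := eval hnf in obs in
      let gens' := eval hnf in gens in
      lazymatch type of H with
      | ?e1 = ?e2 =>
        let l := reify_term obs' gens' e1 in
        let r := reify_term obs' gens' e2 in
        lazymatch eval vm_compute in
          (rewrite_slices arity w d (tsrc arity l) (slices arity l) (slices arity r)) with
        | Some ?d' =>
          refine (@draws_rewrite _ obs arity gens M l r w d w' e d' H _ _ _);
            [vm_compute; reflexivity | vm_compute; reflexivity |]
        | None => fail "no such occurrence"
        end
      end
    end
  end.

Ltac drawn M :=
  lazymatch type of M with
  | @well_typed_gens _ ?obs ?arity ?gens =>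
    lazymatch goal with
    | |- draws _ _ _ ?w ?d ?w' ?e =>
      let obs' := eval hnf in obs in
      let gens' := eval hnf in gens in
      let t := reify_term obs' gens' e in
      refine (@draws_end _ obs arity gens M t w d w' _); vm_compute; reflexivity
    end
  end.

(** * Naturality of the braiding, strand by strand *)

Section BraidingNaturality.
Variable C : strictBraidedCat.
Implicit Types A B D : ob C.

Lemma braid_natl A B D (f : mor C) : hom A B f ->
  braid B D ∘ (f ⊗ idm D) = (idm D ⊗ f) ∘ braid A D.
Proof. by case=> <- <-; rewrite -{1}(cod_idm D) braid_natural dom_idm. Qed.

Lemma braid_natr A B D (f : mor C) : hom A B f ->
  braid D B ∘ (idm D ⊗ f) = (f ⊗ idm D) ∘ braid D A.
Proof. by case=> <- <-; rewrite -{1}(cod_idm D) braid_natural dom_idm. Qed.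

(** The digits count the strands entering and leaving [f]. The hexagons split braidings with tensor
    products into crossings of single strands, the only ones available as generators. *)
Lemma braid_natl21 A A' B D (f : mor C) : hom (A ⊗ A') B f ->
  braid B D ∘ (f ⊗ idm D) =
  (idm D ⊗ f) ∘ ((braid A D ⊗ idm A') ∘ (idm A ⊗ braid A' D)).
Proof. by move/braid_natl->; rewrite braid_tensl. Qed.

Lemma braid_natl12 A B B' D (f : mor C) : hom A (B ⊗ B') f ->
  (braid B D ⊗ idm B') ∘ (idm B ⊗ braid B' D) ∘ (f ⊗ idm D) =
  (idm D ⊗ f) ∘ braid A D.
Proof. by rewrite -braid_tensl; apply: braid_natl. Qed.

Lemma braid_natr21 A A' B D (f : mor C) : hom (A ⊗ A') B f ->
  braid D B ∘ (idm D ⊗ f) =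
  (f ⊗ idm D) ∘ ((idm A ⊗ braid D A') ∘ (braid D A ⊗ idm A')).
Proof. by move/braid_natr->; rewrite braid_tensr. Qed.

Lemma braid_natr12 A B B' D (f : mor C) : hom A (B ⊗ B') f ->
  (idm B ⊗ braid D B') ∘ (braid D B ⊗ idm B') ∘ (idm D ⊗ f) =
  (f ⊗ idm D) ∘ braid D A.
Proof. by rewrite -braid_tensr; apply: braid_natr. Qed.

(* [braid unit_ob D] is idempotent by the hexagon, and invertible. *)
Lemma braid_unitl D : braid unit_ob D = idm D.
Proof.
have e := braid_tensl unit_ob unit_ob D; rewrite tens_ob1l tens1r tens1l in e.
have [u [du cu] [uK _]] := braid_iso unit_ob D.
have [db cb] := braid_hom unit_ob D.
rewrite tens_ob1l tens_ob1r in du cu db cb uK.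
by rewrite -[LHS](comp_id_cod cb) -{1}uK -compA ?du ?cb ?db // -e.
Qed.

Lemma braid_unitr D : braid D unit_ob = idm D.
Proof.
have e := braid_tensr D unit_ob unit_ob; rewrite tens_ob1l tens1r tens1l in e.
have [u [du cu] [uK _]] := braid_iso D unit_ob.
have [db cb] := braid_hom D unit_ob.
rewrite tens_ob1l tens_ob1r in du cu db cb uK.
by rewrite -[LHS](comp_id_cod cb) -{1}uK -compA ?du ?cb ?db // -e.
Qed.

Lemma braid_natl01 B D (f : mor C) : hom unit_ob B f ->
  braid B D ∘ (f ⊗ idm D) = idm D ⊗ f.
Proof.
move=> hf; rewrite (braid_natl D hf) braid_unitl comp_id_dom // dom_tens dom_idm.
by case: hf => ->; rewrite tens_ob1r.
Qed.

Lemma braid_natr01 B D (f : mor C) : hom unit_ob B f ->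
  braid D B ∘ (idm D ⊗ f) = f ⊗ idm D.
Proof.
move=> hf; rewrite (braid_natr D hf) braid_unitr comp_id_dom // dom_tens dom_idm.
by case: hf => ->; rewrite tens_ob1l.
Qed.

Lemma braid_natl10 A D (f : mor C) : hom A unit_ob f ->
  (idm D ⊗ f) ∘ braid A D = f ⊗ idm D.
Proof.
move=> hf; rewrite -(braid_natl D hf) braid_unitl comp_id_cod // cod_tens cod_idm.
by case: hf => _ ->; rewrite tens_ob1l.
Qed.

Lemma braid_natr10 A D (f : mor C) : hom A unit_ob f ->
  (f ⊗ idm D) ∘ braid D A = idm D ⊗ f.
Proof.
move=> hf; rewrite -(braid_natr D hf) braid_unitr comp_id_cod // cod_tens cod_idm.
by case: hf => _ ->; rewrite tens_ob1r.
Qed.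

End BraidingNaturality.

(** * Diagrams of a Hopf datum *)

Section HopfDatumDiagrams.
Variables (C : strictBraidedCat) (H : hopfData C) (Hh : is_hopf_datum H).

Local Notation B1 := (ob1 H).
Local Notation B2 := (ob2 H).
Local Notation m1 := (mul1 H).
Local Notation η1 := (one1 H).
Local Notation Δ1 := (comul1 H).
Local Notation ε1 := (counit1 H).
Local Notation m2 := (mul2 H).
Local Notation η2 := (one2 H).
Local Notation Δ2 := (comul2 H).
Local Notation ε2 := (counit2 H).
Local Notation μl := (actl H).
Local Notation νl := (coactl H).
Local Notation μr := (actr H).
Local Notation νr := (coactr H).
Local Notation id1 := (idm B1).
Local Notation id2 := (idm B2).
Local Notation Ψ11 := (braid B1 B1).
Local Notation Ψ12 := (braid B1 B2).
Local Notation Ψ21 := (braid B2 B1).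
Local Notation Ψ22 := (braid B2 B2).
Local Notation φ12 := (phi12 H).
Local Notation φ21 := (phi21 H).

(* A wire labelled 0 is [B1], a wire labelled 1 is [B2]. *)
Definition hopf_obs : seq (ob C) := [:: B1; B2].

Definition hopf_arity : seq (seq nat * seq nat) :=
  [:: ([:: 0; 0], [:: 0]); ([::], [:: 0]); ([:: 0], [:: 0; 0]); ([:: 0], [::]);
      ([:: 1; 1], [:: 1]); ([::], [:: 1]); ([:: 1], [:: 1; 1]); ([:: 1], [::]);
      ([:: 1; 0], [:: 0]); ([:: 0], [:: 1; 0]);
      ([:: 1; 0], [:: 1]); ([:: 1], [:: 1; 0]);
      ([:: 0; 1], [:: 1; 0]); ([:: 1; 0], [:: 0; 1]);
      ([:: 0; 0], [:: 0; 0]); ([:: 0; 1], [:: 1; 0]);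
      ([:: 1; 0], [:: 0; 1]); ([:: 1; 1], [:: 1; 1])].

Definition hopf_gens : seq (mor C) :=
  [:: m1; η1; Δ1; ε1; m2; η2; Δ2; ε2; μl; νl; μr; νr; φ12; φ21;
      Ψ11; Ψ12; Ψ21; Ψ22].

Lemma phi21_hom : hom (B2 ⊗ B1) (B1 ⊗ B2) φ21.
Proof.
have [hl _ _] := actl_module Hh; have [hr _ _] := actr_module Hh.
have h1 := comult_hom (coalgebra1 Hh); have h2 := comult_hom (coalgebra2 Hh).
apply: hom_comp (hom_tens h2 h1) _; rewrite !tens_obA.
have hb := hom_tens (hom_tens (hom_idm B2) (braid_hom B2 B1)) (hom_idm B1).
rewrite !tens_obA in hb; apply: hom_comp hb _.
by move: (hom_tens hl hr); rewrite !tens_obA.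
Qed.

Lemma phi12_hom : hom (B1 ⊗ B2) (B2 ⊗ B1) φ12.
Proof.
have [hl _ _] := coactl_comodule Hh; have [hr _ _] := coactr_comodule Hh.
have h1 := mult_hom (algebra1 Hh); have h2 := mult_hom (algebra2 Hh).
apply: hom_comp (hom_tens hl hr) _; rewrite !tens_obA.
have hb := hom_tens (hom_tens (hom_idm B2) (braid_hom B1 B2)) (hom_idm B1).
rewrite !tens_obA in hb; apply: hom_comp hb _.
by move: (hom_tens h2 h1); rewrite !tens_obA.
Qed.

Lemma hopf_gens_typed : well_typed_gens hopf_obs hopf_arity hopf_gens.
Proof.
have [[hl _ _] [hr _ _]] := (actl_module Hh, actr_module Hh).
have [[kl _ _] [kr _ _]] := (coactl_comodule Hh, coactr_comodule Hh).
have [[hm1 he1 _ _ _] [hm2 he2 _ _ _]] := (algebra1 Hh, algebra2 Hh).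
have [[hd1 hc1 _ _ _] [hd2 hc2 _ _ _]] := (coalgebra1 Hh, coalgebra2 Hh).
have [hp hq] := (phi12_hom, phi21_hom).
(* One case per generator, in the order of [hopf_gens]; the braidings come last. *)
do 18 (case=> [_|]; first by
  rewrite /src /tgt /genI /= !tens_ob1r //; apply: braid_hom).
by [].
Qed.

Let M := hopf_gens_typed.

(** As [φ21] is a generator of its own in diagrams, unfolding and refolding it are rewriting
    steps. *)
Lemma phi21E : φ21 = (μl ⊗ μr) ∘ (id2 ⊗ Ψ21 ⊗ id1) ∘ (Δ2 ⊗ Δ1).
Proof. by []. Qed.

Lemma phi12E : φ12 = (m2 ⊗ m1) ∘ (id2 ⊗ Ψ12 ⊗ id1) ∘ (νl ⊗ νr).
Proof. by []. Qed.

(** * Compatibility of [φ21] with products and of [φ12] with coproducts *)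

Lemma phi21_mul2 :
  φ21 ∘ (m2 ⊗ id1) = (id1 ⊗ m2) ∘ (φ21 ⊗ id2) ∘ (id2 ⊗ φ21).
Proof.
have [hl lA _] := actl_module Hh; have [hr rA _] := actr_module Hh.
draw M.
redraw M phi21E.
redraw M (alg_coalg2 Hh).
redraw M (braid_natl21 B1 (mult_hom (algebra2 Hh))).
redraw M lA.
redraw M (mod_alg2 Hh).
redraw M phi21E.
redraw M (braid_natl21 B1 hr).
redraw M (esym rA).
(* The Sweedler formula is reached. Next, the legs [b1, b2] and [x1, x2] are regrouped so that each
   pair comes from one coproduct. *)
redraw M (esym (braid_natl12 B1 (comult_hom (coalgebra2 Hh)))).
redraw M (esym (comultA (coalgebra1 Hh))).
redraw M (esym (comultA (coalgebra2 Hh))).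
redraw M (braid_natr12 B2 (comult_hom (coalgebra1 Hh))).
redraw M (esym (braid_natr21 B2 hl)).
(* The regrouped legs form [Δ1 ∘ μl], which leaves two copies of [φ21] to refold. *)
redraw M (esym (mod_coalg1 Hh)).
redraw M (esym phi21E).
redraw M (esym phi21E).
drawn M.
Qed.

(** Left-right mirror image of [phi21_mul2], step by step; coassociativity is used in the opposite
    direction. *)
Lemma phi21_mul1 :
  φ21 ∘ (id2 ⊗ m1) = (m1 ⊗ id2) ∘ (id1 ⊗ φ21) ∘ (φ21 ⊗ id1).
Proof.
have [hl lA _] := actl_module Hh; have [hr rA _] := actr_module Hh.
draw M.
redraw M phi21E.
redraw M (alg_coalg1 Hh).
redraw M (braid_natr21 B2 (mult_hom (algebra1 Hh))).
redraw M rA.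
redraw M (mod_alg1 Hh).
redraw M phi21E.
redraw M (braid_natr21 B2 hl).
redraw M (esym lA).
redraw M (esym (braid_natr12 B2 (comult_hom (coalgebra1 Hh)))).
redraw M (comultA (coalgebra1 Hh)).
redraw M (comultA (coalgebra2 Hh)).
redraw M (braid_natl12 B1 (comult_hom (coalgebra2 Hh))).
redraw M (esym (braid_natl21 B1 hr)).
redraw M (esym (mod_coalg2 Hh)).
redraw M (esym phi21E).
redraw M (esym phi21E).
drawn M.
Qed.

(** Upside-down image of [phi21_mul2]: products and coproducts are exchanged, and so are actions and
    coactions. *)
Lemma comul2_phi12 :
  (Δ2 ⊗ id1) ∘ φ12 = (id2 ⊗ φ12) ∘ (φ12 ⊗ id2) ∘ (id1 ⊗ Δ2).
Proof.
have [hl lA _] := coactl_comodule Hh; have [hr rA _] := coactr_comodule Hh.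
draw M.
redraw M phi12E.
redraw M (alg_coalg2 Hh).
redraw M (esym (braid_natr12 B1 (comult_hom (coalgebra2 Hh)))).
redraw M lA.
redraw M (comod_coalg2 Hh).
redraw M phi12E.
redraw M (esym (braid_natr12 B1 hr)).
redraw M (esym rA).
redraw M (braid_natr21 B1 (mult_hom (algebra2 Hh))).
redraw M (esym (multA (algebra1 Hh))).
redraw M (esym (multA (algebra2 Hh))).
redraw M (esym (braid_natl21 B2 (mult_hom (algebra1 Hh)))).
redraw M (braid_natl12 B2 hl).
redraw M (esym (comod_alg1 Hh)).
redraw M (esym phi12E).
redraw M (esym phi12E).
drawn M.
Qed.

(** Upside-down image of [phi21_mul1]. *)
Lemma comul1_phi12 :
  (id2 ⊗ Δ1) ∘ φ12 = (φ12 ⊗ id1) ∘ (id1 ⊗ φ12) ∘ (Δ1 ⊗ id2).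
Proof.
have [hl lA _] := coactl_comodule Hh; have [hr rA _] := coactr_comodule Hh.
draw M.
redraw M phi12E.
redraw M (alg_coalg1 Hh).
redraw M (esym (braid_natl12 B2 (comult_hom (coalgebra1 Hh)))).
redraw M rA.
redraw M (comod_coalg1 Hh).
redraw M phi12E.
redraw M (esym (braid_natl12 B2 hl)).
redraw M (esym lA).
redraw M (braid_natl21 B2 (mult_hom (algebra1 Hh))).
redraw M (multA (algebra1 Hh)).
redraw M (multA (algebra2 Hh)).
redraw M (esym (braid_natr21 B1 (mult_hom (algebra2 Hh)))).
redraw M (braid_natr12 B1 hr).
redraw M (esym (comod_alg2 Hh)).
redraw M (esym phi12E).
redraw M (esym phi12E).
drawn M.
Qed.

(** * Compatibility with units and counits *)

Lemma phi21_one2 : φ21 ∘ (η2 ⊗ id1) = id1 ⊗ η2.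
Proof.
have [_ _ lI] := actl_module Hh; have [hη dη _] := one2_coalgmor Hh.
draw M.
redraw M phi21E.
(* The unit is duplicated by [Δ2]: the left copy acts trivially, and the right one turns the second
   leg of [Δ1] into [η2 ∘ ε1]. *)
redraw M dη.
redraw M (braid_natl01 B1 hη).
redraw M lI.
redraw M (actr_one Hh).
redraw M (comult_counitr (coalgebra1 Hh)).
drawn M.
Qed.

Lemma phi21_one1 : φ21 ∘ (id2 ⊗ η1) = η1 ⊗ id2.
Proof.
have [_ _ rI] := actr_module Hh; have [hη dη _] := one1_coalgmor Hh.
draw M.
redraw M phi21E.
redraw M dη.
redraw M (braid_natr01 B2 hη).
redraw M rI.
redraw M (actl_one Hh).
redraw M (comult_counitl (coalgebra2 Hh)).
drawn M.
Qed.

Lemma counit2_phi12 : (ε2 ⊗ id1) ∘ φ12 = id1 ⊗ ε2.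
Proof.
have [_ _ lI] := coactl_comodule Hh; have [hε mε _] := counit2_algmor Hh.
draw M.
redraw M phi12E.
(* Dually, [ε2] splits over the product: one factor cancels the coaction [νl], the other turns [νr]
   into [η1 ∘ ε2]. *)
redraw M mε.
redraw M (braid_natr10 B1 hε).
redraw M lI.
redraw M (esym (coactr_counit Hh)).
redraw M (mult_unitr (algebra1 Hh)).
drawn M.
Qed.

Lemma counit1_phi12 : (id2 ⊗ ε1) ∘ φ12 = ε1 ⊗ id2.
Proof.
have [_ _ rI] := coactr_comodule Hh; have [hε mε _] := counit1_algmor Hh.
draw M.
redraw M phi12E.
redraw M mε.
redraw M (braid_natl10 B2 hε).
redraw M rI.
redraw M (esym (coactl_counit Hh)).
redraw M (mult_unitl (algebra2 Hh)).
drawn M.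
Qed.

(** * Algebra and coalgebra structures on the tensor product *)

Lemma mulB_algebra : is_algebra (obB H) (mulB H) (oneB H).
Proof.
have [h1 e1 _ _ _] := algebra1 Hh; have [h2 e2 _ _ _] := algebra2 Hh.
rewrite /mulB /oneB /obB; split.
- have := hom_tens (hom_tens (hom_idm B1) phi21_hom) (hom_idm B2).
  have := hom_tens h1 h2.
  by rewrite !tens_obA => hm hφ; apply: hom_comp hφ hm.
- by rewrite -{1}[unit_ob]tens_ob1l; apply: hom_tens.
(* The identity of B is split into two wires to be drawable. Then [m2] slides up through [φ21], and
   after reassociation an [m1] slides back down through it. *)
- rewrite -tens_idm; draw M.
  redraw M phi21_mul2.
  redraw M (multA (algebra1 Hh)).
  redraw M (esym phi21_mul1).
  redraw M (multA (algebra2 Hh)).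
  drawn M.
- rewrite -tens_idm; draw M.
  redraw M phi21_one2.
  redraw M (mult_unitl (algebra1 Hh)).
  redraw M (mult_unitl (algebra2 Hh)).
  drawn M.
- rewrite -tens_idm; draw M.
  redraw M phi21_one1.
  redraw M (mult_unitr (algebra1 Hh)).
  redraw M (mult_unitr (algebra2 Hh)).
  drawn M.
Qed.

Lemma comulB_coalgebra : is_coalgebra (obB H) (comulB H) (counitB H).
Proof.
have [h1 e1 _ _ _] := coalgebra1 Hh; have [h2 e2 _ _ _] := coalgebra2 Hh.
rewrite /comulB /counitB /obB; split.
- have := hom_tens (hom_tens (hom_idm B1) phi12_hom) (hom_idm B2).
  have := hom_tens h1 h2.
  by rewrite !tens_obA => hm hφ; apply: hom_comp hm hφ.
- by rewrite -[unit_ob]tens_ob1l; apply: hom_tens.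
- rewrite -tens_idm; draw M.
  redraw M comul2_phi12.
  redraw M (comultA (coalgebra1 Hh)).
  redraw M (esym comul1_phi12).
  redraw M (comultA (coalgebra2 Hh)).
  drawn M.
- rewrite -tens_idm; draw M.
  redraw M counit2_phi12.
  redraw M (comult_counitl (coalgebra1 Hh)).
  redraw M (comult_counitl (coalgebra2 Hh)).
  drawn M.
- rewrite -tens_idm; draw M.
  redraw M counit1_phi12.
  redraw M (comult_counitr (coalgebra1 Hh)).
  redraw M (comult_counitr (coalgebra2 Hh)).
  drawn M.
Qed.

End HopfDatumDiagrams.

Theorem proposition2p6 (C : strictBraidedCat) (C_split : idempotents_split C)
    (H : hopfData C) (H_hopf : is_hopf_datum H) :
  is_algebra (obB H) (mulB H) (oneB H) /\
  is_coalgebra (obB H) (comulB H) (counitB H).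
Proof. by split; [apply: mulB_algebra | apply: comulB_coalgebra]. Qed.
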